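(* Let $n\in\mathbb{N}$ and let $\mathcal{C}\subseteq\{0,1\}^n$ be an extremal class. Suppose there is a finite sequence of extremal classes $\mathcal{C}=\mathcal{C}_0\supsetneq\mathcal{C}_1\supsetneq\dots\supsetneq\mathcal{C}_m$ with $m\ge 1$ such that each pair $(\mathcal{C}_i,\mathcal{C}_{i+1})$, $0\le i<m$, satisfies the cubical colour condition, and such that $\mathcal{C}_m$ has VC dimension at most $2$. Then $\mathcal{C}$ has an unlabelled compression scheme of size equal to the VC dimension of $\mathcal{C}$.
   Context: $[n]=\{1,\dots,n\}$; $\mathrm{proj}_I(v)=(v_i)_{i\in I}$ for $I\subseteq[n]$, and $\mathrm{proj}_I(\mathcal{C})=\{\mathrm{proj}_I(v):v\in\mathcal{C}\}$. A class $\mathcal{C}\subseteq\{0,1\}^n$ shatters $I$ if $\mathrm{proj}_I(\mathcal{C})=\{0,1\}^{|I|}$; its VC dimension is the maximum of $|I|$ over shattered $I$. A cube with colour set $I\subseteq[n]$ is a set of all points of $\{0,1\}^n$ having prescribed values on $[n]\setminus I$ (so single vertices are cubes with empty colour set). A cube of $\mathcal{C}$ is a cube contained in $\mathcal{C}$; it is maximal if it is not properly contained in another cube of $\mathcal{C}$. $\mathcal{C}$ is extremal if whenever $\mathcal{C}$ shatters $I$, $\mathcal{C}$ contains a cube with colour set $I$. For extremal classes $\mathcal{D}\subsetneq\mathcal{C}$, the pair $(\mathcal{C},\mathcal{D})$ satisfies the cubical colour condition if for every cube of $\mathcal{C}$ which is not maximal in $\mathcal{C}$ there is a cube of $\mathcal{D}$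 with the same colour set. An unlabelled compression scheme (representation mapping) of size $k$, where $k<n$, of $\mathcal{C}$ is a map $r$ such that (1) $r$ is an injection from $\mathcal{C}$ to the subsets of $[n]$ of size at most $k$, and (2) (non-clashing) $\mathrm{proj}_{r(v)\cup r(v')}(v)\neq\mathrm{proj}_{r(v)\cup r(v')}(v')$ for all $v\neq v'$ in $\mathcal{C}$.
   Formalization: The proviso k<n in the definition of an unlabelled compression scheme of size k is dropped, since the hypotheses allow C={0,1}^n (e.g. n=3, C_1 = C minus a vertex), whose VC dimension is n; in all other cases the proviso holds automatically. *)

(* Defs.v *)
From mathcomp Require Import all_boot.

Set Implicit Arguments.
Unset Strict Implicit.
Unset Printing Implicit Defensive.

(* The ground set [n] is 'I_n, and {0,1}^n is {ffun 'I_n -> bool}. *)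
Definition vertex (n : nat) := {ffun 'I_n -> bool}.

Section Classes.
Variable n : nat.
Implicit Types (C D B : {set vertex n}) (I J : {set 'I_n}).

(* Points of {0,1}^I. *)
Definition pvertex I := {ffun {i : 'I_n | i \in I} -> bool}.

Definition proj I (v : vertex n) : pvertex I := [ffun i => v (val i)].

Definition shatters C I : bool := proj I @: C == [set: pvertex I].

(* The empty class shatters nothing, not even the empty set; with this
   definition its VC dimension is 0. *)
Definition vcdim C : nat := \max_(I : {set 'I_n} | shatters C I) #|I|.

(* All vertices with the values prescribed by x outside I. *)
Definition cube I (x : pvertex (~: I)) : {set vertex n} :=
  [set v | proj (~: I) v == x].

(* B is a cube with colour set I. *)
Definition is_cube I B : Prop := exists x : pvertex (~: I), B = cube x.

Definition is_cube_of C I B : Prop := is_cube I B /\ B \subset C.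

Definition maximal_cube_of C I B : Prop :=
  is_cube_of C I B /\
  ~ (exists J, exists B', is_cube_of C J B' /\ B \proper B').

Definition extremal C : Prop :=
  forall I, shatters C I -> exists B, is_cube_of C I B.

Definition cubical_colour_condition C D : Prop :=
  forall I B, is_cube_of C I B -> ~ maximal_cube_of C I B ->
    exists B', is_cube_of D I B'.

(* Only the values of r on C matter.  The proviso k < n that sometimes
   accompanies this notion is not imposed: it would exclude the full cube
   {0,1}^n, whose VC dimension is n. *)
Definition unlabelled_compression_scheme (k : nat) C
    (r : vertex n -> {set 'I_n}) : Prop :=
  [/\ {in C &, injective r},
      (forall v, v \in C -> #|r v| <= k) &
      (forall v v', v \in C -> v' \in C -> v <> v' ->
         proj (r v :|: r v') v <> proj (r v :|: r v') v')].

End Classes.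

(* Main.v *)
Require Import Defs.
From mathcomp Require Import all_boot all_algebra.

(** A representation map of [D] extends to [C] as soon as the sets that [C]
    shatters and [D] does not form an antichain [S].  For [I] in [S] choose a
    vertex [c I] of an [I]-cube of [C] whose pattern on [I] is missed by [D].
    Over the field with two elements consider the matrices
    [A J x = (x agrees with c J on J)] and [L x I = (x is in the I-cube of c I)],
    with [x] in [C :\: D].  For [I <> J], flipping a coordinate of [I :\: J]
    pairs off the terms of [(A L) J I], so [A L = 1].  Extremality makes the
    matrices square, hence [L A = 1], and its diagonal shows that every [x] in
    [C :\: D] is some [c I]; thus [c] is a bijection and its inverse is the
    required extension.

    An extremal class of VC dimension at most 2 is reduced in the same way:
    if [H] is a side [v e = a] of [C] with fewest elements, remove from [C] all
    of [H] except one end of an [e]-edge (or all of [H] if it is a singleton).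
    By minimality of [H], only 2-sets (or only [{e}]) cease to be shattered. *)

Set Implicit Arguments.
Unset Strict Implicit.
Unset Printing Implicit Defensive.

Import GRing.Theory.

Section Representation.
Variable n : nat.
Implicit Types (C D : {set vertex n}) (I J K : {set 'I_n}) (u v w x : vertex n).

(** * Agreement on a set of coordinates *)

Definition agree I v w : bool := [forall i in I, v i == w i].

Lemma agreeP I v w : reflect {in I, v =1 w} (agree I v w).
Proof. by apply: (iffP forall_inP) => h i /h /eqP. Qed.

Lemma agreexx I v : agree I v v.
Proof. exact/agreeP. Qed.

Lemma agree_sym I v w : agree I v w = agree I w v.
Proof. by apply/agreeP/agreeP => h i /h ->. Qed.

Lemma agree_trans I u v w : agree I u v -> agree I v w -> agree I u w.
Proof. by move=> /agreeP h /agreeP k; apply/agreeP => i iI; rewrite h ?k. Qed.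

Lemma agreeS I J v w : I \subset J -> agree J v w -> agree I v w.
Proof. by move=> /subsetP s /agreeP h; apply/agreeP => i /s /h. Qed.

Lemma agree_eq I v w : agree I v w -> agree (~: I) v w -> v = w.
Proof.
move=> /agreeP h /agreeP k; apply/ffunP => i.
by case: (boolP (i \in I)) => [/h|]; rewrite -?in_setC // => /k.
Qed.

Lemma agree_proj I v w : agree I v w <-> proj I v = proj I w.
Proof.
split=> [/agreeP h|/ffunP h]; first by apply/ffunP=> -[i iI]; rewrite !ffunE h.
by apply/agreeP => i iI; move: (h (Sub i iI)); rewrite !ffunE.
Qed.

Definition mix I v w : vertex n := [ffun i => if i \in I then v i else w i].

Lemma mix_agree I v w : agree I (mix I v w) v.
Proof. by apply/agreeP => i iI; rewrite ffunE iI. Qed.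

Lemma mix_agreeC I v w : agree (~: I) (mix I v w) w.
Proof. by apply/agreeP => i; rewrite inE ffunE => /negPf ->. Qed.

Lemma proj_surj I (p : pvertex I) : exists v, proj I v = p.
Proof.
exists [ffun i => if insub i is Some j then p j else false].
by apply/ffunP=> j; rewrite !ffunE valK.
Qed.

Lemma shattersP C I :
  reflect (forall x, exists2 v, v \in C & agree I v x) (shatters C I).
Proof.
apply: (iffP eqP) => [h x|h].
  have: proj I x \in proj I @: C by rewrite h inE.
  by case/imsetP=> v vC /esym/agree_proj; exists v.
apply/setP=> p; rewrite inE; have [x <-] := proj_surj p.
by have [v vC /agree_proj <-] := h x; apply: imset_f.
Qed.

(** The cube is given by any one of its vertices [x], so that points of the dependent type [pvertex]
    need not be handled. *)
Definition has_cube C I x : Prop := forall v, agree (~: I) v x -> v \in C.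

Lemma is_cube_ofP C I :
  (exists B, is_cube_of C I B) <-> exists x, has_cube C I x.
Proof.
split=> [[B [[p ->]] s]|[x h]].
  have [x xp] := proj_surj p; exists x => v /agree_proj vx.
  by apply: (subsetP s); rewrite inE vx xp.
exists (cube (proj (~: I) x)); split; first by exists (proj (~: I) x).
by apply/subsetP=> v; rewrite inE => /eqP/agree_proj /h.
Qed.

Lemma extremal_has_cube C I :
  extremal C -> shatters C I -> exists x, has_cube C I x.
Proof. by move=> e /e /is_cube_ofP. Qed.

Lemma has_cube_extremal C :
  (forall I, shatters C I -> exists x, has_cube C I x) -> extremal C.
Proof. by move=> h I /h /is_cube_ofP. Qed.

Lemma has_cube_shatters C I x : has_cube C I x -> shatters C I.
Proof.
move=> h; apply/shattersP => y; exists (mix I y x); last exact: mix_agree.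
exact/h/mix_agreeC.
Qed.

Lemma shattersS C D I J :
  C \subset D -> J \subset I -> shatters C I -> shatters D J.
Proof.
move=> /subsetP sCD sJI /shattersP h; apply/shattersP => x.
by have [v /sCD vD vx] := h x; exists v => //; apply: agreeS vx.
Qed.

(** * Counting shattered sets *)

Definition shattered C : {set {set 'I_n}} := [set I | shatters C I].

(** Induct by splitting [C] along a coordinate [e] on which two of its vertices differ. Sets
    shattered by a half avoid [e]; a set [K] shattered by both halves is counted twice, but then [C]
    shatters [e |: K] as well. *)
Lemma Pajor C : #|C| <= #|shattered C|.
Proof.
have [m] := ubnP #|C|; elim: m C => // m IH C.
rewrite ltnS => leCm.
have [C1|[u [v [uC vC /eqP uv]]]] :
    #|C| <= 1 \/ exists u v, [/\ u \in C, v \in C & u <> v].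
  have [->|[u uC]] := set_0Vmem C; first by left; rewrite cards0.
  have [|] := boolP (C \subset [set u]).
    by move/subset_leq_card; rewrite cards1; left.
  by case/subsetPn=> v vC; rewrite inE => /eqP vu; right; exists v, u.
  have [->|[u uC]] := set_0Vmem C; first by rewrite cards0.
  apply: leq_trans C1 _; apply/card_gt0P; exists set0; rewrite inE.
  by apply/shattersP=> x; exists u => //; apply/agreeP=> i; rewrite inE.
have [e uve] : exists e, u e != v e.
  apply/existsP; apply: contraR uv => /existsPn h.
  by apply/eqP/ffunP => i; apply/eqP; move: (h i); rewrite negbK.
pose H b := [set w in C | w e == b].
have sH b : H b \subset C by apply/subsetP=> w; rewrite inE => /andP[].
have H0 b : 0 < #|H b|.
  apply/card_gt0P; have [ub|ub] := eqVneq (u e) b.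
    by exists u; rewrite inE uC ub eqxx.
  by exists v; rewrite inE vC; move: uve ub; case: (u e) (v e) b => [] [] [].
have cH : #|C| = #|H true| + #|H false|.
  rewrite -(cardsID [set w : vertex n | w e] C).
  congr (_ + _); apply: eq_card => w; first by rewrite !inE eqb_id.
  by rewrite !inE eqbF_neg andbC.
have ltH b : #|H b| < #|C|.
  rewrite cH; case: b; first by rewrite -[ltnLHS]addn0 ltn_add2l.
  by rewrite -[ltnLHS]add0n ltn_add2r.
have He b K : K \in shattered (H b) -> e \notin K.
  rewrite inE => /shattersP h; apply/negP => eK.
  have [w] := h [ffun=> ~~ b]; rewrite inE => /andP[_ /eqP we] /agreeP /(_ e eK).
  by rewrite ffunE we; case: (b).
have IHb b : #|H b| <= #|shattered (H b)| by apply/IH/(leq_trans (ltH b)).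
apply: leq_trans (_ : #|shattered (H true)| + #|shattered (H false)| <= _).
  by rewrite cH leq_add.
rewrite -cardsUI.
pose P := shattered (H true) :&: shattered (H false).
have -> : #|P| = #|[set e |: K | K in P]|.
  rewrite card_in_imset // => K L; rewrite !inE => /andP[KP _] /andP[LP _] E.
  have eK : e \notin K by apply: (He true); rewrite inE.
  have eL : e \notin L by apply: (He true); rewrite inE.
  by rewrite -(setU1K eK) E setU1K.
set Q := imset _ _; rewrite -cardsUI (_ : #|_ :&: Q| = 0) ?addn0.
  apply: subset_leq_card; apply/subsetP=> K; rewrite inE => /orP[].
    by rewrite !inE => /orP[]; apply: shattersS.
  case/imsetP=> L; rewrite !inE => /andP[/shattersP h1 /shattersP h0] ->.
  apply/shattersP => x.
  have [w] : exists2 w, w \in H (x e) & agree L w x by case: (x e).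
  rewrite inE => /andP[wC /eqP we] /agreeP wx; exists w => //.
  by apply/agreeP=> i; rewrite !inE => /orP[/eqP->//|/wx].
apply/eqP; rewrite cards_eq0; apply/eqP/setP=> K; rewrite !inE.
apply/negP=> /andP[Kh /imsetP[L _ KL]].
have : e \in K by rewrite KL !inE eqxx.
by apply/negP; case/orP: Kh => Kh; [apply: (He true)|apply: (He false)]; rewrite inE.
Qed.

Lemma card_extremal C : extremal C -> #|C| = #|shattered C|.
Proof.
move=> eC; apply/eqP; rewrite eqn_leq Pajor /=.
(* A cube of [C] with colours [I] is a pattern on the complement of [I] missed
   by the complement of [C]. *)
have disj : [disjoint [set ~: I | I in shattered C] & shattered (~: C)].
  apply/pred0P => J /=; apply/negP => /andP[/imsetP[I]].
  rewrite inE => /(extremal_has_cube eC) [x h] ->; rewrite inE.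
  by case/shattersP/(_ x) => v vC /h; move: vC; rewrite inE => /negPf ->.
(* There are [2 ^ n] sets in all, and the Pajor bound for [~: C] leaves at most [#|C|] of them for
   [shattered C]. *)
have := max_card (mem ([set ~: I | I in shattered C] :|: shattered (~: C))).
rewrite cardsU (eqP (_ : _ :&: _ == set0)) ?setI_eq0 // cards0 subn0.
rewrite (card_imset _ (@setC_inj _)) => h.
rewrite -(leq_add2r #|shattered (~: C)|) (leq_trans h) //.
apply: leq_trans (leq_add (leqnn _) (Pajor _)).
by rewrite cardsC -[leqLHS]cardsT -powersetT card_powerset cardsT card_ffun
  card_bool !card_ord.
Qed.

(** * Parity and matrices over the field with two elements *)

Definition flip i v : vertex n := [ffun j => (j == i) (+) v j].

Lemma flipK i : involutive (flip i).
Proof. by move=> v; apply/ffunP=> j; rewrite !ffunE addbA addbb. Qed.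

Lemma agree_flip I i v : i \notin I -> agree I (flip i v) v.
Proof.
move=> iI; apply/agreeP=> j jI; rewrite ffunE.
by case: eqP jI => // ->; rewrite (negPf iI).
Qed.

(** The involution [flip i] matches the vertices of [A] with value true at [i] with those with value
    false. *)
Lemma even_card_flip i (A : {set vertex n}) :
  (forall v, v \in A -> flip i v \in A) -> ~~ odd #|A|.
Proof.
move=> hA; pose P := [set v : vertex n | v i].
suff -> : #|A| = #|A :&: P|.*2 by rewrite odd_double.
rewrite -addnn -{1}(cardsID P A); congr (_ + _).
rewrite -[RHS](card_imset _ (inv_inj (flipK i))); apply: eq_card => v.
apply/idP/imsetP=> [|[w + ->]]; rewrite !inE => /andP[hv hA'].
  exists (flip i v); rewrite ?flipK // !inE ffunE eqxx /=.
  by move: hv hA' => /= ? ?; rewrite ?hA //=; apply/andP; split; auto.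
by rewrite ffunE eqxx hA' hA.
Qed.

(** The two sizes are only provably equal, whereas [mulmx1C] wants a square type; destructing the
    equality bridges this. *)
Lemma mulmx1C_eq (R : comNzRingType) p q (A : 'M[R]_(p, q)) (B : 'M[R]_(q, p)) :
  p = q -> (A *m B = 1%:M -> B *m A = 1%:M)%R.
Proof. by move=> e; case: q / e A B => A B; apply: mulmx1C. Qed.

Lemma natr_F2 m : (m%:R = (odd m)%:R :> 'F_2)%R.
Proof.
rewrite -{1}[m]odd_double_half natrD -muln2 natrM.
by rewrite [X in (_ * X)%R](_ : _ = 0%R) ?mulr0 ?addr0 //; apply/val_inj.
Qed.

Definition antichain (S : {set {set 'I_n}}) : Prop :=
  {in S &, forall I J, I \subset J -> I = J}.

Section NewSets.
Variables (C D : {set vertex n}) (c : {set 'I_n} -> vertex n).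
Let S := shattered C :\: shattered D.
Let T := C :\: D.
Hypotheses (eC : extremal C) (eD : extremal D) (sDC : D \subset C).
Hypothesis antiS : antichain S.
Hypothesis cubec : forall I, I \in S -> has_cube C I (c I).
Hypothesis missc : forall I v, I \in S -> v \in D -> ~~ agree I v (c I).

Lemma card_new_sets : #|S| = #|T|.
Proof.
have sS : shattered D \subset shattered C.
  by apply/subsetP=> I; rewrite !inE; apply: shattersS.
by rewrite !cardsD (setIidPr sS) (setIidPr sDC) -!card_extremal.
Qed.

(** Modulo 2 the cardinal is the entry of [A L] in row [J] and column [I]. For [I = J] the only
    vertex counted is [c I]. *)
Lemma odd_cube_meet I J : I \in S -> J \in S ->
  odd #|[set v in T | agree J v (c J) && agree (~: I) v (c I)]| = (I == J).
Proof.
move=> IS JS; case: eqVneq => [<-|nIJ].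
  suff -> : [set v in T | agree I v (c I) && agree (~: I) v (c I)] = [set c I].
    by rewrite cards1.
  apply/setP=> v; rewrite !inE; apply/idP/eqP => [/andP[_ /andP[]]|->].
    exact: agree_eq.
  rewrite !agreexx (cubec IS) ?agreexx ?andbT //.
  by apply/negP=> /(missc IS); rewrite agreexx.
have /subsetPn[i iI iJ] : ~~ (I \subset J).
  by apply: contra nIJ => /(antiS IS JS) ->.
apply/negbTE/(@even_card_flip i) => v; rewrite !inE -!andbA.
case/and4P=> _ _ vJ vI.
have {}vJ : agree J (flip i v) (c J) by apply: agree_trans vJ; apply: agree_flip.
have {}vI : agree (~: I) (flip i v) (c I).
  by apply: agree_trans vI; apply: agree_flip; rewrite inE negbK.
(* The flipped vertex stays in the [I]-cube, hence in [C]; it is outside [D] because its pattern on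
   [J] is that of [c J]. *)
rewrite vJ vI (cubec IS) // !andbT.
by apply/negP=> /(missc JS); rewrite vJ.
Qed.

Lemma new_sets_surj v : v \in T -> exists2 I, I \in S & v = c I.
Proof.
move=> vT.
pose A : 'M['F_2]_(#|S|, #|T|) := (\matrix_(j, x)
  (agree (enum_val j) (enum_val x) (c (enum_val j)))%:R)%R.
pose L : 'M['F_2]_(#|T|, #|S|) := (\matrix_(x, i)
  (agree (~: enum_val i) (enum_val x) (c (enum_val i)))%:R)%R.
have AL : (A *m L = 1%:M)%R.
  apply/matrixP=> j i; rewrite !mxE.
  have iS := enum_valP i; have jS := enum_valP j.
  rewrite -(inj_eq enum_val_inj) eq_sym -(odd_cube_meet iS jS) -natr_F2.
  rewrite -[in RHS]sum1_card natr_sum [RHS]big_mkcond /=.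
  under eq_bigr do rewrite !mxE.
  rewrite -(big_enum_val (fun x => (agree (enum_val j) x (c (enum_val j)))%:R
     * (agree (~: enum_val i) x (c (enum_val i)))%:R)%R) /=.
  rewrite big_mkcond; apply: eq_bigr => x _; rewrite !inE.
  rewrite -natrM mulnb; case: ifP => /= _; last by rewrite ?if_same.
  by case: (_ && _).
have /matrixP LA := mulmx1C_eq card_new_sets AL.
pose k := enum_rank_in vT v; have := LA k k; rewrite !mxE eqxx.
have [/exists_inP[I IS /eqP ->]|/exists_inPn h] := boolP [exists I in S, v == c I].
  by exists I.
(* If [v] were no [c I], each term of the diagonal entry would vanish: agreement with [c I] on [I]
   and off [I] forces equality. *)
rewrite big1 => [/esym/eqP|i _]; first by rewrite oner_eq0.
rewrite !mxE enum_rankK_in // -natrM mulnb.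
case: andP => // -[a b]; case/negP: (h _ (enum_valP i)).
by apply/eqP; apply: agree_eq a.
Qed.

(** The images of [S] under [c] cover [T], and [S] has just as many elements as [T]. *)
Lemma new_sets_inj : {in S &, injective c}.
Proof.
apply/imset_injP; rewrite eqn_leq leq_imset_card card_new_sets.
by apply: subset_leq_card; apply/subsetP=> v /new_sets_surj[I IS ->]; apply: imset_f.
Qed.

End NewSets.

(** * Projection onto [K], encoded without leaving the type [vertex n] *)

Definition mask K v : vertex n := mix K v [ffun=> false].

Lemma maskP K v : agree K (mask K v) v.
Proof. exact: mix_agree. Qed.

Lemma mask_out K v i : i \notin K -> mask K v i = false.
Proof. by rewrite !ffunE => /negPf ->. Qed.

Lemma eq_mask K v w : agree K v w -> mask K v = mask K w.
Proof.
by move=> /agreeP h; apply/ffunP=> i; rewrite !ffunE; case: ifP => // /h.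
Qed.

Lemma agree_mask I K v w : I \subset K -> agree I (mask K v) w = agree I v w.
Proof.
move=> sIK; have h := agreeS sIK (maskP K v).
by apply/idP/idP; apply: agree_trans; rewrite // agree_sym.
Qed.

Lemma agree_mask2 I K v w :
  I \subset K -> agree I (mask K v) (mask K w) = agree I v w.
Proof.
by move=> sIK; rewrite agree_mask // agree_sym agree_mask // agree_sym.
Qed.

Lemma shatters_mask K C I :
  shatters (mask K @: C) I = (I \subset K) && shatters C I.
Proof.
apply/shattersP/andP => [h|[sIK /shattersP h] x].
  have sIK : I \subset K.
    apply/subsetP=> i iI; apply: contraT => iK.
    have [_ /imsetP[v _ ->] /agreeP /(_ i iI)] := h [ffun=> true].
    by rewrite mask_out // ffunE.
  split=> //; apply/shattersP=> x; have [_ /imsetP[v vC ->]] := h x.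
  by rewrite agree_mask //; exists v.
by have [v vC vx] := h x; exists (mask K v); rewrite ?imset_f ?agree_mask.
Qed.

Lemma has_cube_mask K C I x :
  I \subset K -> has_cube C I x -> has_cube (mask K @: C) I (mask K x).
Proof.
move=> sIK h v /agreeP vx; apply/imsetP.
exists (mix I v x); first exact/h/mix_agreeC.
apply/ffunP=> i; rewrite !ffunE; have := vx i; rewrite inE.
case: (boolP (i \in I)) => iI; first by rewrite (subsetP sIK _ iI).
by move=> -> //; rewrite !ffunE.
Qed.

Lemma extremal_mask K C : extremal C -> extremal (mask K @: C).
Proof.
move=> eC; apply: has_cube_extremal => I; rewrite shatters_mask => /andP[sIK].
by case/(extremal_has_cube eC) => x h; exists (mask K x); apply: has_cube_mask.
Qed.

(* Masking outside [I :|: J] turns two clashing vertices into equal ones. *)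
Lemma new_sets_nonclashing C D (c : {set 'I_n} -> vertex n)
    (S := shattered C :\: shattered D) :
  extremal C -> extremal D -> D \subset C -> antichain S ->
  (forall I, I \in S -> has_cube C I (c I)) ->
  (forall I v, I \in S -> v \in D -> ~~ agree I v (c I)) ->
  {in S &, forall I J, agree (I :|: J) (c I) (c J) -> I = J}.
Proof.
move=> eC eD sDC antiS cubec missc I J IS JS cIJ; pose K := I :|: J.
pose S' := shattered (mask K @: C) :\: shattered (mask K @: D).
(* The new sets of the masked classes are the members of [S] inside [K], so the antichain condition
   is inherited. *)
have S'P L : (L \in S') = (L \subset K) && (L \in S).
  by rewrite !inE !shatters_mask; case: (L \subset K).
have eCD : extremal (mask K @: C) /\ extremal (mask K @: D).
  by split; apply: extremal_mask.
apply: (new_sets_inj (c := mask K \o c) eCD.1 eCD.2); rewrite -/S'.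
- exact: imsetS.
- by move=> L M; rewrite !S'P => /andP[_ LS] /andP[_ MS]; apply: antiS.
- by move=> L; rewrite S'P => /andP[LK LS]; apply/has_cube_mask/cubec.
- move=> L _ /[!S'P] /andP[LK LS] /imsetP[v vD ->].
  by rewrite agree_mask2 // missc.
- by rewrite S'P subsetUl.
- by rewrite S'P subsetUr.
- exact: eq_mask.
Qed.

(** * Representation maps and their extension *)

Definition represents C (r : vertex n -> {set 'I_n}) : Prop :=
  [/\ {in C &, injective r},
      (forall v, v \in C -> shatters C (r v)) &
      {in C &, forall v w, agree (r v :|: r w) v w -> v = w}].

Lemma not_shattersP D I :
  ~~ shatters D I -> exists x, forall v, v \in D -> ~~ agree I v x.
Proof.
move=> nI; have : ~~ [forall x, [exists v in D, agree I v x]].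
  apply: contra nI => /forallP h; apply/shattersP => x.
  by have /exists_inP[v] := h x; exists v.
by case/forallPn=> x /exists_inPn h; exists x.
Qed.

(** The map is kept on [D], and a vertex [c I] outside [D] receives [I]. Values on [D] are shattered
    by [D], hence differ from the sets in [S]; a mixed pair does not clash since [D] misses the
    pattern of [c I] on [I]. *)
Lemma extend_representation C D :
  extremal C -> extremal D -> D \subset C ->
  antichain (shattered C :\: shattered D) ->
  (exists r, represents D r) -> exists r, represents C r.
Proof.
move=> eC eD sDC antiS [r [r_inj r_sh r_nc]].
set S := _ :\: _ in antiS.
have /fin_all_exists[c cP] I : exists x, I \in S ->
    has_cube C I x /\ forall v, v \in D -> ~~ agree I v x.
  case: (boolP (I \in S)) => [|_]; last by exists [ffun=> false].
  rewrite !inE => /andP[/not_shattersP[p hp] /(extremal_has_cube eC)[y hy]].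
  (* Inside the [I]-cube through [y], pick the vertex showing the missed pattern [p]. *)
  exists (mix I p y) => _; split=> v.
    by move=> h; apply/hy/(agree_trans h)/mix_agreeC.
  by move=> /hp; apply: contra => h; apply: agree_trans h (mix_agree _ _ _).
have cubec I : I \in S -> has_cube C I (c I) by case/cP.
have missc I v : I \in S -> v \in D -> ~~ agree I v (c I) by case/cP => _; apply.
(* The default [set0] is never reached on [C]: outside [D], surjectivity of [c] makes [pick]
   succeed. *)
pose r' v := if v \in D then r v else odflt set0 [pick I in S | c I == v].
have r'D v : v \in D -> r' v = r v by rewrite /r' => ->.
have r'N v : v \in C -> v \notin D -> r' v \in S /\ c (r' v) = v.
  move=> vC vD; rewrite /r' (negPf vD); case: pickP => [I /andP[? /eqP]//|h].
  have vT : v \in C :\: D by rewrite inE vD.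
  have [I IS vI] := new_sets_surj eC eD sDC antiS cubec missc vT.
  by have := h I; rewrite IS vI eqxx.
have r'DN v w : v \in D -> w \in C -> w \notin D ->
    r' v <> r' w /\ ~~ agree (r' v :|: r' w) v w.
  move=> vD wC wD; have [wS cw] := r'N _ wC wD; split.
    move=> e; move: wS; rewrite -e (r'D _ vD) !inE.
    by rewrite r_sh.
  apply: contra (missc _ _ wS vD) => h; rewrite cw.
  by apply: agreeS h; apply: subsetUr.
exists r'; split.
- move=> v w vC wC.
  case: (boolP (v \in D)) (boolP (w \in D)) => vD [] wD.
  + by rewrite !r'D //; apply: r_inj.
  + by case: (r'DN _ _ vD wC wD).
  + by move/esym; case: (r'DN _ _ wD vC vD).
  + by move=> e; rewrite -(r'N _ vC vD).2 e (r'N _ wC wD).2.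
- move=> v vC; case: (boolP (v \in D)) => vD.
    by rewrite r'D //; apply: (shattersS sDC (subxx _)); apply: r_sh.
  by have [] := r'N _ vC vD; rewrite !inE => /andP[].
- move=> v w vC wC.
  case: (boolP (v \in D)) (boolP (w \in D)) => vD [] wD.
  + by rewrite !r'D //; apply: r_nc.
  + by case: (r'DN _ _ vD wC wD) => _ /negPf ->.
  + by rewrite setUC agree_sym; case: (r'DN _ _ wD vC vD) => _ /negPf ->.
  + have [vS {2 3}<-] := r'N _ vC vD; have [wS {2 3}<-] := r'N _ wC wD.
    by move=> /(new_sets_nonclashing eC eD sDC antiS cubec missc vS wS) ->.
Qed.

(** * Halves of a class, and adding one edge to a half *)

Lemma agreeC1P e v w :
  reflect (forall i, i != e -> v i = w i) (agree (~: [set e]) v w).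
Proof. by apply: (iffP (agreeP _ _ _)) => h i; have := h i; rewrite !inE. Qed.

Section Halfspace.
Variables (C : {set vertex n}) (e : 'I_n) (a : bool).
Let C0 := [set v in C | v e != a].

Lemma shatters_halfspace I : shatters C0 I -> e \notin I.
Proof.
move=> /shattersP h; apply/negP=> eI.
have [v] := h [ffun=> a]; rewrite inE => /andP[_ va] /agreeP /(_ e eI).
by rewrite ffunE => /eqP; rewrite (negPf va).
Qed.

(** If the [I]-cube of [C] lies on the wrong side of [e], it supplies the patterns on [e |: I] with
    value [a] at [e], and [C0] the others. So [C] has a cube with colours [e |: I], and one of its
    faces lies in [C0]. *)
Lemma extremal_halfspace : extremal C -> extremal C0.
Proof.
move=> eC; apply: has_cube_extremal => I shI.
have eI := shatters_halfspace shI; have sC0 : C0 \subset C.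
  by apply/subsetP=> v; rewrite inE => /andP[].
have [y hy] := extremal_has_cube eC (shattersS sC0 (subxx I) shI).
have [ya|ya] := eqVneq (y e) a; last first.
  exists y => v vy; rewrite inE hy //.
  by rewrite (agreeP _ _ _ vy) ?ya // inE.
have [z hz] : exists z, has_cube C (e |: I) z.
  apply: (extremal_has_cube eC); apply/shattersP=> p.
  have [pa|pa] := eqVneq (p e) a.
    exists (mix I p y); first exact/hy/mix_agreeC.
    apply/agreeP=> i; rewrite !inE ffunE => /orP[/eqP ->|->//].
    by rewrite (negPf eI) ya.
  have [v] := (shattersP _ _ shI) p; rewrite inE => /andP[vC va] /agreeP vp.
  exists v => //; apply/agreeP=> i; rewrite !inE => /orP[/eqP ->|/vp//].
  by move: va pa; case: (v e) (p e) (a) => [] [] [].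
exists (mix [set e] [ffun=> ~~ a] z) => v /agreeP vz; rewrite inE hz.
  by rewrite vz ?inE // !ffunE !inE eqxx; case: (a).
apply/agreeP=> i; rewrite !inE negb_or => /andP[ie iI].
by rewrite vz ?inE // ffunE inE (negPf ie).
Qed.

Variables t0 t1 : vertex n.
Hypotheses (t0C0 : t0 \in C0) (t1a : t1 e = a).
Hypothesis t01 : agree (~: [set e]) t0 t1.

(** Only [t1] can have value [a] at [e], so no [j] other than [e] can accompany [e] in [I]: the
    negation of [t1 j] would be missed. If [e] is not in [I], then [t0] can replace [t1]. *)
Lemma shatters_thin (E : {set vertex n}) I :
  (forall v, v \in E -> v \in C0 \/ v = t1) -> shatters E I ->
  I = [set e] \/ shatters C0 I.
Proof.
move=> hE /shattersP shI; case: (boolP (e \in I)) => eI; [left|right].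
  apply/eqP; rewrite eqEsubset sub1set eI andbT; apply/subsetP => j jI.
  rewrite inE; apply: contraT => je.
  have [v vE /agreeP vp] := shI [ffun i => if i == e then a else ~~ t1 i].
  case: (hE _ vE) => [|v1]; last first.
    by have := vp j jI; rewrite ffunE (negPf je) v1; case: (t1 j).
  by rewrite inE vp // ffunE eqxx eqxx andbF.
apply/shattersP=> x; have [v vE vx] := shI x.
case: (hE _ vE) => [vC|v1]; [by exists v|exists t0 => //].
apply: agree_trans vx; rewrite v1; apply: agreeS t01.
by apply/subsetP=> i iI; rewrite !inE; apply: contraNneq eI => <-.
Qed.

Lemma has_cube_add_edge : has_cube (t1 |: C0) [set e] t0.
Proof.
move=> v vt; rewrite in_setU1; have [va|va] := eqVneq (v e) a.
  apply/orP; left; apply/eqP; apply: (@agree_eq [set e]).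
    by apply/agreeP=> i; rewrite inE => /eqP ->; rewrite t1a.
  exact: agree_trans vt t01.
suff -> : v = t0 by rewrite t0C0 orbT.
apply: (@agree_eq [set e]) => //; apply/agreeP=> i; rewrite inE => /eqP ->.
move: t0C0; rewrite inE => /andP[_]; move: va.
by case: (v e) (t0 e) (a) => [] [] [].
Qed.

Lemma extremal_add_edge : extremal C -> extremal (t1 |: C0).
Proof.
move=> eC; apply: has_cube_extremal => I /shatters_thin[v|->|].
- by rewrite in_setU1 => /orP[/eqP|]; auto.
- exists t0; exact: has_cube_add_edge.
- case/(extremal_has_cube (extremal_halfspace eC)) => x h; exists x => v /h vC.
  by rewrite in_setU1 vC orbT.
Qed.

End Halfspace.

(** * Classes of VC dimension at most 2 *)

Lemma representation_low_dim C :
  extremal C -> (forall I, shatters C I -> #|I| <= 2) ->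
  exists r, represents C r.
Proof.
have [m] := ubnP #|C|; elim: m C => // m IH C; rewrite ltnS => leCm eC dimC.
case: (boolP [forall e, ~~ shatters C [set e]])
  => [/forallP noe|/forallPn[e0 /negPn she0]].
  (* With no singleton shattered, [C] has at most one vertex and the constant map [set0] works. *)
  have sub0 I : shatters C I -> I = set0.
    move=> shI; apply/eqP; rewrite -subset0; apply/subsetP=> i iI.
    case/negP: (noe i); apply: shattersS shI => //.
    by rewrite sub1set.
  have /card_le1_eqP C1 : #|C| <= 1.
    rewrite (card_extremal eC) -(cards1 (set0 : {set 'I_n})).
    apply/subset_leq_card/subsetP=> I.
    by rewrite !inE => /sub0 ->.
  exists (fun=> set0); split=> [v w vC wC _|v vC|v w vC wC _]; try exact: C1.
  apply/shattersP=> x; exists v => //.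
  by apply/agreeP=> i; rewrite inE.
pose H (p : 'I_n * bool) := [set v in C | v p.1 == p.2].
have IHD D : extremal D -> D \proper C -> exists r, represents D r.
  move=> eD pD; apply: IH => //; first exact: leq_trans (proper_card pD) _.
  by move=> I shI; apply/dimC/(shattersS (proper_sub pD) (subxx I)).
(* Minimise only over coordinates whose singleton is shattered, so that extremality provides an edge
   across the chosen side. *)
case: (@arg_minnP _ (e0, true) (fun p => shatters C [set p.1])
  (fun p => #|H p|) she0) => -[e a] /= she minH.
pose C0 := [set v in C | v e != a].
have [x hx] := extremal_has_cube eC she.
pose t0 := mix [set e] [ffun=> ~~ a] x; pose t1 := mix [set e] [ffun=> a] x.
have t1a : t1 e = a by rewrite !ffunE inE eqxx.
have t1C : t1 \in C by exact/hx/mix_agreeC.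
have t0C0 : t0 \in C0.
  by rewrite inE hx ?mix_agreeC //= !ffunE inE eqxx; case: (a).
have t01 : agree (~: [set e]) t0 t1.
  by apply: agree_trans (mix_agreeC _ _ _) _; rewrite agree_sym mix_agreeC.
have sC0 : C0 \subset C by apply/subsetP=> v; rewrite inE => /andP[].
have t1C0 : t1 \notin C0 by rewrite inE t1a eqxx andbF.
(* Equality means that the side [H (e, a)] is [t1] alone; then [C0] is the smaller class and only
   [[set e]] can be new. *)
have [DC|DC] := eqVneq (t1 |: C0) C.
  have eC0 := @extremal_halfspace C e a eC.
  apply: (extend_representation eC eC0 sC0); last first.
    by apply: IHD => //; apply/properP; split=> //; exists t1.
  have S1 I : I \in shattered C :\: shattered C0 -> I = [set e].
    rewrite !inE => /andP[nI]; case/(shatters_thin t0C0 t01) => //.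
      by move=> v; rewrite -{1}DC in_setU1 => /orP[/eqP|]; auto.
    by rewrite (negPf nI).
  by move=> I J /S1 -> /S1 ->.
pose D := t1 |: C0.
have sDC : D \subset C by rewrite subUset sub1set t1C.
have eD : extremal D by apply: extremal_add_edge t0C0 t1a t01 eC.
apply: (extend_representation eC eD sDC); last first.
  by apply: IHD => //; rewrite properEneq DC.
suff S2 I : I \in shattered C :\: shattered D -> #|I| = 2.
  by move=> I J /S2 cI /S2 cJ sIJ; apply/eqP; rewrite eqEcard sIJ cI cJ.
(* It remains to see that [D] still shatters the empty set and every singleton shattered by [C]. *)
rewrite !inE => /andP[nI shI]; apply/eqP; rewrite eqn_leq dimC //=.
rewrite ltnNge; apply: contra nI; rewrite leq_eqVlt ltnS leqn0 cards_eq0.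
have t0D : t0 \in D by rewrite in_setU1 t0C0 orbT.
case/orP=> [/cards1P[g Ig]|/eqP ->]; last first.
  by apply/shattersP=> y; exists t0 => //; apply/agreeP=> i; rewrite inE.
subst I; have [->|ge] := eqVneq g e.
  exact: has_cube_shatters (has_cube_add_edge t0C0 t1a t01).
(* If [g] were constant on [C0], its other side would be contained in the
   side [H (e, a)], properly since it misses [t1]. *)
apply: contraT => nD.
have cst v : v \in C0 -> v g = t0 g.
  move=> vC0; apply: contraNeq nD => vg; apply/shattersP=> y.
  have [yt|yt] := eqVneq (y g) (t0 g).
    by exists t0 => //; apply/agreeP=> i; rewrite inE => /eqP ->.
  exists v; first by rewrite in_setU1 vC0 orbT.
  apply/agreeP=> i; rewrite inE => /eqP ->.
  by move: vg yt; case: (v g) (t0 g) (y g) => [] [] [].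
have sH : H (g, ~~ t0 g) \subset H (e, a).
  apply/subsetP=> v; rewrite !inE /= => /andP[vC vg]; rewrite vC /=.
  apply: contraT => va; have := cst v; rewrite inE vC va => /(_ isT) E.
  by move: vg; rewrite E; case: (t0 g).
have /eqP HE : H (g, ~~ t0 g) == H (e, a) by rewrite eqEcard sH minH.
have : t1 \in H (e, a) by rewrite inE t1C /= t1a eqxx.
rewrite -HE inE /= -(agreeC1P _ _ _ t01 g ge) t1C.
by case: (t0 g).
Qed.

(** * Back to compression schemes and the cubical colour condition *)

Lemma represents_scheme C r :
  represents C r -> unlabelled_compression_scheme (vcdim C) C r.
Proof.
case=> r_inj r_sh r_nc; split=> // [v vC|v w vC wC vw /agree_proj /(r_nc _ _ vC wC)//].
exact: leq_bigmax_cond (r_sh v vC).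
Qed.

(** Were [I] properly inside [J] with both new, an [I]-face of a [J]-cube of [C] would be a
    non-maximal cube; the condition then yields an [I]-cube of [D], which makes [D] shatter [I]. *)
Lemma cubical_colour_antichain C D :
  extremal C -> cubical_colour_condition C D ->
  antichain (shattered C :\: shattered D).
Proof.
move=> eC ccc I J; rewrite !inE => /andP[nI _] /andP[_ shJ] sIJ.
apply: contraNeq nI => neIJ.
have [x hx] := extremal_has_cube eC shJ.
pose cubeK K := cube (proj (~: K) x).
have cubeE K v : (v \in cubeK K) = agree (~: K) v x.
  by rewrite inE; apply/eqP/idP => /agree_proj.
have sK : cubeK I \subset cubeK J.
  by apply/subsetP=> v; rewrite !cubeE; apply: agreeS; rewrite setCS.
have JC : is_cube_of C J (cubeK J).
  split; first by exists (proj (~: J) x).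
  by apply/subsetP=> v; rewrite cubeE => /hx.
have IC : is_cube_of C I (cubeK I).
  by split; [exists (proj (~: I) x) | apply: subset_trans sK JC.2].
suff nmax : ~ maximal_cube_of C I (cubeK I).
  have /is_cube_ofP[y hy] := ccc _ _ IC nmax.
  exact: has_cube_shatters hy.
case=> _; apply; exists J, (cubeK J); split=> //; rewrite properE sK.
have /subsetPn[j jJ jI] : ~~ (J \subset I).
  by apply: contra neIJ => sJI; rewrite eqEsubset sIJ.
(* Moving [x] along a colour [j] of [J] outside [I] leaves the [I]-cube but not the [J]-cube. *)
apply/subsetPn; exists (flip j x); rewrite cubeE.
  by apply: agree_flip; rewrite inE jJ.
apply/negP=> /agreeP/(_ j); rewrite inE ffunE eqxx => /(_ jI).
by case: (x j).
Qed.

End Representation.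

Theorem mainTheorem4 (n : nat) (C : {set vertex n}) (extC : extremal C)
  (m : nat) (Cs : nat -> {set vertex n})
  (m_ge1 : 1 <= m)
  (Cs0 : Cs 0 = C)
  (extCs : forall i, i <= m -> extremal (Cs i))
  (decCs : forall i, i < m -> Cs i.+1 \proper Cs i)
  (cccCs : forall i, i < m -> cubical_colour_condition (Cs i) (Cs i.+1))
  (vcCm : vcdim (Cs m) <= 2) :
  exists r : vertex n -> {set 'I_n},
    unlabelled_compression_scheme (vcdim C) C r.
Proof.
suff [r rP] : exists r, represents (Cs 0) r.
  by exists r; rewrite -Cs0; apply: represents_scheme.
(* Here [k] counts the steps back from the last class, where the low-dimensional case starts the
   induction. *)
suff H k : k <= m -> exists r, represents (Cs (m - k)) r.
  by rewrite -(subnn m); apply: H.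
elim: k => [_|k IH km].
  rewrite subn0; apply: representation_low_dim => [|I shI]; first exact: extCs.
  by apply: leq_trans vcCm; apply: leq_bigmax_cond.
have lt : m - k.+1 < m by rewrite -subn_gt0 subKn.
have E : (m - k.+1).+1 = m - k by rewrite -subSn // subSS.
apply: (@extend_representation _ _ (Cs (m - k.+1).+1)).
- exact/extCs/ltnW.
- exact: extCs.
- exact/proper_sub/decCs.
- by apply: cubical_colour_antichain; [exact/extCs/ltnW | exact: cccCs].
- by rewrite E; apply/IH/ltnW.
Qed.
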